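(* Let $[\pi_1]\in Gr(2,4)$ and let $W_{[\pi_1]}=\{[\pi_2]\in Gr(2,4)\ |\ \pi_1\wedge\pi_2=0\}$. In a neighborhood of $[\pi_2]=[\pi_1]$, the $3$-variety $W_{[\pi_1]}$ is a cone.
   Context: $Gr(2,4)$ is the Grassmannian of $2$-planes in $\mathbb R^4$, viewed via the Plücker embedding as the set of classes $[\pi]\in\mathbb P(\Lambda^2\mathbb R^4)$ of nonzero bivectors with $\pi\wedge\pi=0$. $W_{[\pi_1]}$ is the fiber over $[\pi_1]$, under the first projection, of $W=\{([\pi_1],[\pi_2])\in Gr(2,4)\times Gr(2,4)\ |\ \pi_1\wedge\pi_2=0\}$. Meaning of ''cone'': choose a basis ${\bf e}_1,\dots,{\bf e}_4$ of $\mathbb R^4$ with $[\pi_1]=[{\bf e}_1\wedge{\bf e}_2]$, and let $[q_{12},q_{13},q_{14},q_{23},q_{24},q_{34}]$ be the homogeneous coordinates of $[\pi_2]$ with respect to the basis ${\bf e}_i\wedge{\bf e}_j$, $i<j$. Near $[\pi_1]$ normalize $q_{12}=1$ and use $(\alpha,\beta,\gamma,\delta)=(q_{13},q_{14},q_{23},q_{24})$ as local coordinates on $Gr(2,4)$ centred at $[\pi_1]$. Being a cone means that in these coordinates $W_{[\pi_1]}$ is $\{(\alpha,\beta,\gamma,\delta)\in\mathbb R^4\ |\ \alpha\delta-\beta\gamma=0\}$. *)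

(* Defs.v *)
From HB Require Import structures.
From mathcomp Require Import all_boot all_order all_algebra.
From mathcomp Require Import generic_quotient.
From mathcomp Require Import all_classical all_reals all_analysis.
Set Implicit Arguments.
Unset Strict Implicit.
Unset Printing Implicit Defensive.
Import Order.TTheory GRing.Theory Num.Theory.
Import numFieldNormedType.Exports.
Local Open Scope classical_set_scope.
Local Open Scope ring_scope.

(* The exterior power Lambda^k(R^n) is given by its standard basis e_S, where
   S ranges over the k-element subsets of {0, ..., n-1} and
   e_S = e_(s1) /\ ... /\ e_(sk) for s1 < ... < sk the elements of S. It is
   encoded as the row vectors indexed by such S, so that it inherits the vector
   space structure and the topology of 'rV[R]_('C(n, k)). *)

Definition ksubset (n k : nat) : finType := {S : {set 'I_n} | #|S| == k}.

Notation extpow R n k := 'rV[R]_#|ksubset n k|.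

Section ExteriorPower.
Variables (R : realType) (n : nat).

Definition ecoef k (x : extpow R n k) (S : ksubset n k) : R :=
  x ord0 (enum_rank S).

Definition of_ecoef k (f : ksubset n k -> R) : extpow R n k :=
  \row_i f (enum_val i).

(* e_A /\ e_B = esign A B * e_(A :|: B) for disjoint A and B. *)
Definition esign (A B : {set 'I_n}) : R :=
  (-1) ^+ #|[set ab : 'I_n * 'I_n |
             [&& ab.1 \in A, ab.2 \in B & (ab.2 < ab.1)%N]]|.

(* When #|A| = k, #|B| = l and #|S| = k + l, the equation A :|: B = S forces A
   and B to be disjoint. *)
Definition wedge k l (x : extpow R n k) (y : extpow R n l) :
    extpow R n (k + l) :=
  of_ecoef (fun S => \sum_(A : ksubset n k)
    \sum_(B : ksubset n l | val A :|: val B == val S)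
      esign (val A) (val B) * ecoef x A * ecoef y B).

(* The identification of R^n with Lambda^1(R^n). *)
Definition vec1 (v : 'rV[R]_n) : extpow R n 1 :=
  of_ecoef (fun S => \sum_(i in val S) v ord0 i).

Definition vwedge (u v : 'rV[R]_n) : extpow R n 2 := wedge (vec1 u) (vec1 v).

End ExteriorPower.

(* The projective space P(V), as the quotient of V \ {0} by proportionality,
   with the quotient topology. *)
Section Projective.
Variables (R : realType) (V : normedModType R).

Definition nonzero : set V := [set x : V | x <> 0].

Definition proportional (x y : nonzero) : bool :=
  `[< exists2 k : R, k != 0 & set_val y = k *: set_val x >].

Lemma proportional_refl : reflexive proportional.
Proof. by move=> x; apply/asboolP; exists 1; rewrite ?oner_eq0 ?scale1r. Qed.

Lemma proportional_sym : symmetric proportional.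
Proof.
suff H x y : proportional x y -> proportional y x.
  by move=> x y; apply/idP/idP; apply: H.
move=> /asboolP[k k0 yE]; apply/asboolP; exists k^-1; first by rewrite invr_eq0.
by rewrite yE scalerA mulVf ?scale1r.
Qed.

Lemma proportional_trans : transitive proportional.
Proof.
move=> y x z /asboolP[k k0 yE] /asboolP[l l0 zE]; apply/asboolP.
by exists (l * k); rewrite ?mulf_neq0// zE yE scalerA.
Qed.

Canonical proportional_equiv := EquivRel proportional
  proportional_refl proportional_sym proportional_trans.

Definition projective : topologicalType :=
  quotient_topology {eq_quot proportional}%qT.

Definition proj_class (x : nonzero) : projective :=
  (\pi_(quotient_topology {eq_quot proportional}%qT) x)%qT.

(* p = [x]; in particular x <> 0 *)
Definition is_class (p : projective) (x : V) : Prop :=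
  exists2 u : nonzero, set_val u = x & p = proj_class u.

Definition proj_repr (p : projective) : V :=
  set_val (repr (p : quotient_topology {eq_quot proportional}%qT)).

End Projective.

Section LocalCoordinates.
Variables (R : realType) (T : topologicalType) (n : nat).

(* U is an open neighborhood of p in X, for the topology induced by T, and phi
   restricts to a homeomorphism from U onto R^n mapping p to the origin. *)
Definition local_coordinates (X : set T) (p : T) (U : set T)
    (phi : T -> 'rV[R]_n) : Prop :=
  [/\ exists2 O : set T, open O & U = X `&` O,
      U p,
      phi p = 0,
      {within U, continuous phi} &
      exists psi : 'rV[R]_n -> T,
        [/\ continuous psi,
            forall v, U (psi v),
            forall v, phi (psi v) = v &
            forall q, U q -> psi (phi q) = q]].

End LocalCoordinates.

Section Grassmannian.
Variable R : realType.

Definition PL2 : topologicalType := projective (extpow R 4 2).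

Definition Gr24 : set PL2 :=
  [set p | exists2 x : extpow R 4 2, is_class p x & wedge x x = 0].

Definition W : set (PL2 * PL2) :=
  [set p | [/\ Gr24 p.1, Gr24 p.2 &
    exists x y : extpow R 4 2,
      [/\ is_class p.1 x, is_class p.2 y & wedge x y = 0]]].

Definition W_fiber (p1 : PL2) : set PL2 := [set p2 | W (p1, p2)].

(* For a basis e of R^4: the basis e_i /\ e_j, i < j, of Lambda^2(R^4), in the
   order 12, 13, 14, 23, 24, 34. *)
Definition bivector_basis (e : 4.-tuple 'rV[R]_4) : 6.-tuple (extpow R 4 2) :=
  [tuple vwedge (tnth e 0) (tnth e 1); vwedge (tnth e 0) (tnth e 2);
         vwedge (tnth e 0) (tnth e 3); vwedge (tnth e 1) (tnth e 2);
         vwedge (tnth e 1) (tnth e 3); vwedge (tnth e 2) (tnth e 3)].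

(* The homogeneous coordinates q_12, ..., q_34 of p, in the above order, for a
   chosen representative of p. *)
Definition hcoord (e : 4.-tuple 'rV[R]_4) (p : PL2) (i : 'I_6) : R :=
  coord (bivector_basis e) i (proj_repr p).

Definition chart_domain (e : 4.-tuple 'rV[R]_4) : set PL2 :=
  [set p | Gr24 p /\ hcoord e p 0 <> 0].

(* (alpha, beta, gamma, delta) = (q_13, q_14, q_23, q_24) for the
   representative normalized by q_12 = 1 *)
Definition chart (e : 4.-tuple 'rV[R]_4) (p : PL2) : 'rV[R]_4 :=
  \row_(k < 4) [:: hcoord e p 1 / hcoord e p 0; hcoord e p 2 / hcoord e p 0;
                   hcoord e p 3 / hcoord e p 0; hcoord e p 4 / hcoord e p 0]`_k.

Definition quadric_cone : set 'rV[R]_4 :=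
  [set v | v 0 0 * v 0 3 - v 0 1 * v 0 2 = 0].

End Grassmannian.

(* Main.v *)
Require Import Defs.
From mathcomp Require Import all_boot all_order all_algebra.
From mathcomp Require Import generic_quotient.
From mathcomp Require Import all_classical all_reals all_analysis.
From mathcomp Require Import ring lra.

(** Why the theorem holds. For two bivectors of R^4 the wedge product is one
    number, [wedge_form x y], a nondegenerate symmetric bilinear form on
    Lambda^2(R^4). Expressed in the basis attached to any basis [e] of R^4 it is,
    up to the nonzero factor [vol e],

      x12 y34 - x13 y24 + x14 y23 + x23 y14 - x24 y13 + x34 y12

    (lemma [wedge_form_coord]). Two special cases settle everything. Taking
    x = y, the Grassmannian is the quadric q12 q34 = q13 q24 - q14 q23, so on the
    open set q12 <> 0, normalized by q12 = 1, it is the graph of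
    q34 = alpha delta - beta gamma over the four remaining coordinates: this is
    the chart [chart e], with inverse [chart_inv]. Taking x = e1 /\ e2, the
    incidence condition defining W over [e1 /\ e2] is q34 = 0 (lemma
    [W_fiber_coord]). Hence in the chart W is the cone
    alpha delta - beta gamma = 0.

    That every point of the Grassmannian has the form [e1 /\ e2] is the classical
    fact that a bivector x with x /\ x = 0 is decomposable: two
    rows of its skew matrix of Pluecker coordinates span the corresponding plane
    (lemma [decomposable]).

    The topological half is formal. Openness and continuity on a projective
    space are tested upstairs on nonzero vectors, where the chart is a quotient
    of linear forms and its inverse is polynomial. *)

Import Order.TTheory GRing.Theory Num.Theory.
Import numFieldNormedType.Exports.
Set Implicit Arguments.
Unset Strict Implicit.
Unset Printing Implicit Defensive.
Local Open Scope ring_scope.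

(** * Coefficients of exterior forms indexed by plain sets *)

Section SetCoefficients.
Variables (R : realType) (n : nat).
Implicit Types (A B S : {set 'I_n}) (i j : 'I_n) (u v : 'rV[R]_n).

(** Coefficients extended by zero to all sets: sums over k-subsets become sums
    over sets of cardinal k, with no membership proofs in the index. *)
Definition scoef k (x : extpow R n k) S : R := oapp (ecoef x) 0 (insub S).

Lemma scoef_val k (x : extpow R n k) (S : ksubset n k) :
  ecoef x S = scoef x (val S).
Proof. by rewrite /scoef valK. Qed.

Lemma scoef_eq0 k (x : extpow R n k) S : #|S| != k -> scoef x S = 0.
Proof. by move=> /negbTE Sk; rewrite /scoef insubF. Qed.

Lemma scoef0 k S : scoef (0 : extpow R n k) S = 0.
Proof. by rewrite /scoef; case: insub => //= T; rewrite /ecoef mxE. Qed.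

Lemma scoefP k (x y : extpow R n k) : scoef x =1 scoef y -> x = y.
Proof.
move=> xy; apply/rowP => i.
by have := xy (val (enum_val i)); rewrite -!scoef_val /ecoef enum_valK.
Qed.

Lemma scoefD k (x y : extpow R n k) S : scoef (x + y) S = scoef x S + scoef y S.
Proof.
by rewrite /scoef; case: insub => [T|] /=; rewrite ?addr0 // /ecoef mxE.
Qed.

Lemma scoefZ k a (x : extpow R n k) S : scoef (a *: x) S = a * scoef x S.
Proof.
by rewrite /scoef; case: insub => [T|] /=; rewrite ?mulr0 // /ecoef mxE.
Qed.

Lemma sum_ksubset k (F : {set 'I_n} -> R) (P : pred {set 'I_n}) :
  \sum_(A : ksubset n k | P (val A)) F (val A) =
  \sum_(A : {set 'I_n} | (#|A| == k) && P A) F A.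
Proof. by rewrite -(big_sub_cond [pred A : {set 'I_n} | #|A| == k]). Qed.

Lemma scoef_wedge k l (x : extpow R n k) (y : extpow R n l) S :
  #|S| = (k + l)%N ->
  scoef (wedge x y) S =
  \sum_(A : {set 'I_n} | #|A| == k)
    \sum_(B : {set 'I_n} | (#|B| == l) && (A :|: B == S))
      esign R A B * scoef x A * scoef y B.
Proof.
move=> Skl; pose F A := \sum_(B : {set 'I_n} | (#|B| == l) && (A :|: B == S))
      esign R A B * scoef x A * scoef y B.
rewrite {1}/scoef (insubT (fun A : {set 'I_n} => #|A| == (k + l)%N)) ?Skl //=.
move=> Skl'; rewrite /ecoef mxE enum_rankK.
transitivity (\sum_(A : ksubset n k | predT (val A)) F (val A)).
  apply: eq_bigr => A _; rewrite /F -(sum_ksubset l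
    (fun B => esign R (val A) B * scoef x (val A) * scoef y B)
    (fun B => val A :|: B == S)).
  by apply: eq_bigr => B _; rewrite !scoef_val.
by rewrite (sum_ksubset k F predT); apply: eq_bigl => A; rewrite andbT.
Qed.

(** In top degree the second factor of a nonzero term must be the complement of
    the first, so the double sum collapses. *)
Lemma scoef_wedge_setT k l (x : extpow R n k) (y : extpow R n l) :
  n = (k + l)%N ->
  scoef (wedge x y) [set: 'I_n] =
  \sum_(A : {set 'I_n} | #|A| == k)
    esign R A (~: A) * scoef x A * scoef y (~: A).
Proof.
move=> nkl; rewrite scoef_wedge ?cardsT ?card_ord //.
apply: eq_bigr => A /eqP Ak; rewrite (big_pred1 (~: A)) // => B.
have Al : #|~: A| = l by rewrite cardsCs finset.setCK card_ord Ak nkl addKn.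
apply/andP/eqP => [[/eqP Bl AB]|->]; last first.
  by rewrite Al finset.setUCr !eqxx.
apply/esym/eqP; rewrite eqEcard Al Bl leqnn andbT; apply/fintype.subsetP => i.
by have /setP/(_ i) := eqP AB; rewrite !inE => /orP[->|->].
Qed.

Lemma scoef_vec1 v i : scoef (vec1 v) [set i] = v 0 i.
Proof.
rewrite /scoef (insubT (fun A : {set 'I_n} => #|A| == 1)) ?cards1 // => S1 /=.
by rewrite /ecoef mxE enum_rankK big_set1.
Qed.

Lemma big_card1 (P : pred {set 'I_n}) (F : {set 'I_n} -> R) :
  \sum_(A : {set 'I_n} | (#|A| == 1) && P A) F A =
  \sum_(i | P [set i]) F [set i].
Proof.
rewrite big_mkcondr (eq_bigl (fun A => A \in [set [set i] | i : 'I_n])).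
  by rewrite big_imset /= -?big_mkcond // => i j _ _ /set1_inj.
by move=> A; apply/cards1P/imsetP => [[i ->]|[i _ ->]]; exists i.
Qed.

Lemma big_card2 (F : {set 'I_n} -> R) :
  \sum_(A : {set 'I_n} | #|A| == 2) F A =
  \sum_(i < n) \sum_(j < n | (i < j)%N) F [set i; j].
Proof.
rewrite pair_big_dep /= (eq_bigl (fun A => A \in
  [set [set p.1; p.2] | p : 'I_n * 'I_n & (p.1 < p.2)%N])).
  rewrite big_imset /=; first by apply: eq_bigl => p; rewrite !inE.
  move=> [i j] [k l]; rewrite !inE /= => ij kl /setP E.
  move: (E i) (E j); rewrite !inE !eqxx orbT.
  move=> /esym/pred2P ik /esym/pred2P jl.
  case: ik jl ij kl => -> [] -> //; rewrite ?ltnn // => lk.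
  by rewrite ltnNge ltnW.
move=> A; apply/cards2P/imsetP => [[i [j [ij ->]]]|[[i j] /=]].
  case: (ltngtP i j) ij => [ij _|ji _|/val_inj ->]; last by rewrite eqxx.
  - by exists (i, j); rewrite // !inE.
  - by exists (j, i); rewrite ?inE //= finset.setUC.
rewrite inE /= => ij ->; exists i, j; split=> //.
by apply: contraTneq ij => ->; rewrite ltnn.
Qed.

Lemma esign_prod A B :
  esign R A B = \prod_(a in A) \prod_(b in B) (-1) ^+ (b < a)%N.
Proof.
rewrite /esign mem_setE -sum1_card pair_big_dep /= -prodrXr.
rewrite [LHS]big_mkcond [RHS]big_mkcond /=; apply: eq_bigr => -[a b] _ /=.
by rewrite unfold_in /=; case: (a \in A); case: (b \in B); case: (b < a)%N.
Qed.

Lemma esign11 i j : esign R [set i] [set j] = (-1) ^+ (j < i)%N.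
Proof. by rewrite esign_prod !big_set1. Qed.

Lemma esign22 i j k l : i != j -> k != l ->
  esign R [set i; j] [set k; l] =
  (-1) ^+ (k < i)%N * (-1) ^+ (l < i)%N
  * ((-1) ^+ (k < j)%N * (-1) ^+ (l < j)%N).
Proof.
move=> ij kl; rewrite esign_prod big_setU1 ?big_set1 ?inE //=.
by rewrite !big_setU1 ?big_set1 ?inE.
Qed.

(** * Pluecker coordinates of bivectors *)

(** The entries of the skew-symmetric matrix of a bivector. The sign
    makes them alternating in (i, j) rather than defined for i < j only, so that
    identities hold without ordering the indices. *)
Definition pluecker (x : extpow R n 2) i j : R :=
  esign R [set i] [set j] * scoef x [set i; j].

Lemma plueckerD x y i j :
  pluecker (x + y) i j = pluecker x i j + pluecker y i j.
Proof. by rewrite /pluecker scoefD mulrDr. Qed.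

Lemma plueckerZ a x i j : pluecker (a *: x) i j = a * pluecker x i j.
Proof. by rewrite /pluecker scoefZ mulrCA. Qed.

Lemma pluecker0 i j : pluecker 0 i j = 0.
Proof. by rewrite /pluecker scoef0 mulr0. Qed.

Lemma pluecker_sum I (r : seq I) (P : pred I) (F : I -> extpow R n 2) i j :
  pluecker (\sum_(k <- r | P k) F k) i j =
  \sum_(k <- r | P k) pluecker (F k) i j.
Proof.
apply: (big_morph (fun x => pluecker x i j)) => [x y|]; first exact: plueckerD.
exact: pluecker0.
Qed.

Lemma pluecker_scoef x i j : (i < j)%N -> scoef x [set i; j] = pluecker x i j.
Proof. by move=> ij; rewrite /pluecker esign11 ltnNge ltnW // expr0 mul1r. Qed.

Lemma pluecker_diag x i : pluecker x i i = 0.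
Proof. by rewrite /pluecker scoef_eq0 ?mulr0 // finset.setUid cards1. Qed.

Lemma pluecker_sym x i j : pluecker x j i = - pluecker x i j.
Proof.
have [->|ij] := eqVneq i j; first by rewrite pluecker_diag oppr0.
rewrite /pluecker finset.setUC -mulNr; congr (_ * _); rewrite !esign11.
case: (ltngtP i j) => [_|_|/val_inj/eqP]; last by rewrite (negbTE ij).
  by rewrite expr1 expr0.
by rewrite expr1 expr0 opprK.
Qed.

Lemma plueckerP x y :
  (forall i j, (i < j)%N -> pluecker x i j = pluecker y i j) -> x = y.
Proof.
move=> xy; apply: scoefP => S; case: (boolP (#|S| == 2)) => [|S2]; last first.
  by rewrite !scoef_eq0.
move=> /cards2P[i [j [ij ->]]].
case: (ltngtP i j) ij => [ij _|ji _|/val_inj ->]; last by rewrite eqxx.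
  by rewrite !pluecker_scoef ?xy.
by rewrite finset.setUC !pluecker_scoef ?xy.
Qed.

Lemma pluecker_vwedge u v i j :
  pluecker (vwedge u v) i j = u 0 i * v 0 j - u 0 j * v 0 i.
Proof.
have [->|ij] := eqVneq i j; first by rewrite pluecker_diag subrr.
have card_ij : #|[set i; j]| = (1 + 1)%N by rewrite cards2 ij.
rewrite /pluecker [scoef _ _](scoef_wedge (vec1 u) (vec1 v) card_ij).
rewrite (eq_bigl (fun A => (#|A| == 1) && predT A)); last first.
  by move=> A; rewrite andbT.
rewrite big_card1; under eq_bigr do rewrite big_card1.
(* {a} U {b} = {i, j} has the two solutions (a, b) = (i, j) and (j, i). *)
rewrite (bigD1 i) //= (big_pred1 j) => [|b]; last first.
  apply/eqP/eqP => [/setP E|->//].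
  move: (E j) (E b); rewrite !inE !eqxx (eq_sym j i) (negbTE ij) ?orbT /=.
  by move=> /eqP ->.
rewrite (bigD1 j) 1?eq_sym //= (big_pred1 i) => [|b]; last first.
  apply/eqP/eqP => [/setP E|->]; last by rewrite finset.setUC.
  by move: (E i); rewrite !inE eqxx (negbTE ij) /= => /eqP.
rewrite big1 ?addr0 => [|a /andP[ai aj]]; last first.
  rewrite big_pred0 // => b; apply/eqP => /setP /(_ a).
  by rewrite !inE eqxx (negbTE ai) (negbTE aj).
rewrite !scoef_vec1 !esign11.
case: (ltngtP i j) => [_|_|/val_inj/eqP]; last by rewrite (negbTE ij).
  by rewrite !expr0 !expr1; ring.
by rewrite !expr0 !expr1; ring.
Qed.

Lemma vwedgeDl u u' v : vwedge (u + u') v = vwedge u v + vwedge u' v.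
Proof.
by apply: plueckerP => i j _; rewrite plueckerD !pluecker_vwedge !mxE; ring.
Qed.

Lemma vwedgeZl a u v : vwedge (a *: u) v = a *: vwedge u v.
Proof.
by apply: plueckerP => i j _; rewrite plueckerZ !pluecker_vwedge !mxE; ring.
Qed.

Lemma vwedgeC u v : vwedge u v = - vwedge v u.
Proof.
rewrite -scaleN1r.
by apply: plueckerP => i j _; rewrite plueckerZ !pluecker_vwedge; ring.
Qed.

Lemma vwedgeDr u v v' : vwedge u (v + v') = vwedge u v + vwedge u v'.
Proof. by rewrite vwedgeC vwedgeDl opprD -!(vwedgeC u). Qed.

Lemma vwedgeZr a u v : vwedge u (a *: v) = a *: vwedge u v.
Proof. by rewrite vwedgeC vwedgeZl -scalerN -(vwedgeC u). Qed.

Lemma vwedge_diag u : vwedge u u = 0.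
Proof.
apply: plueckerP => i j _; rewrite pluecker0 pluecker_vwedge; ring.
Qed.

Lemma vwedge0l v : vwedge 0 v = 0.
Proof. by have := vwedgeZl 0 v v; rewrite !scale0r. Qed.

Lemma bivector_sum (x : extpow R n 2) :
  x = \sum_(i < n) \sum_(j < n | (i < j)%N)
        pluecker x i j *: vwedge (delta_mx 0 i) (delta_mx 0 j).
Proof.
apply: plueckerP => k l kl; rewrite pluecker_sum.
under eq_bigr do rewrite pluecker_sum.
under eq_bigr do under eq_bigr do rewrite plueckerZ pluecker_vwedge !mxE /=.
rewrite (bigD1 k) //= (bigD1 l) //= !eqxx mul1r eq_sym.
have -> : (k == l) = false by apply: contraTF kl => /eqP ->; rewrite ltnn.
rewrite mul0r subr0 mulr1 !big1 ?addr0 // => [i ik|j /andP[kj jl]].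
  rewrite big1 // => j ij; rewrite eq_sym (negbTE ik) mul0r sub0r.
  have [li|_] := eqVneq l i; last by rewrite mul0r oppr0 mulr0.
  have [kj|_] := eqVneq k j; last by rewrite mulr0 oppr0 mulr0.
  by move: ij; rewrite -li -kj ltnNge ltnW.
by rewrite eq_sym (negbTE jl) mulr0 mul0r subrr mulr0.
Qed.

Lemma span_decomposable (U : {vspace extpow R n 2}) :
  (forall u v, vwedge u v \in U) -> U = fullv.
Proof.
move=> Uvw; apply/vspaceP => x; rewrite memvf.
rewrite [x]bivector_sum; apply: rpred_sum => i _; apply: rpred_sum => j _.
exact/rpredZ/Uvw.
Qed.

Lemma vwedge_span m (e : m.-tuple 'rV[R]_n) (U : {vspace extpow R n 2}) :
  (forall i j : 'I_m, vwedge (tnth e i) (tnth e j) \in U) ->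
  {in <<e>>%VS &, forall u v, vwedge u v \in U}.
Proof.
move=> Ue u v /coord_span uE /coord_span vE; rewrite {}uE.
elim/big_ind: _ => [|x y xU yU|i _]; first by rewrite vwedge0l mem0v.
  by rewrite vwedgeDl rpredD.
rewrite vwedgeZl rpredZ // {}vE.
elim/big_ind: _ => [|x y xU yU|j _].
- by rewrite vwedgeC vwedge0l oppr0 mem0v.
- by rewrite vwedgeDr rpredD.
- by rewrite vwedgeZr rpredZ // -!tnth_nth.
Qed.

Lemma free_vwedge u v : vwedge u v <> 0 -> free [:: u; v].
Proof.
move=> uv; rewrite free_cons span_seq1 seq1_free; apply/andP; split.
  by apply/vlineP => -[k uE]; apply: uv; rewrite uE vwedgeZl vwedge_diag scaler0.
by apply/eqP => v0; apply: uv; rewrite v0 vwedgeC vwedge0l oppr0.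
Qed.

End SetCoefficients.

Lemma free_extend (K : fieldType) (vT : vectType K) (X : seq vT) :
  free X -> exists Y : seq vT, basis_of fullv (X ++ Y).
Proof.
move=> X_free; exists (vbasis <<X>>^C).
rewrite -(addv_complf <<X>>) cat_basis ?vbasisP //.
  by apply/directv_addP; exact: capv_compl.
by rewrite /basis_of eqxx.
Qed.

(** * The wedge product of bivectors of R^4 as a bilinear form *)

Lemma ord4P (P : 'I_4 -> Prop) : P 0 -> P 1 -> P 2 -> P 3 -> forall i, P i.
Proof.
move=> P0 P1 P2 P3 [[|[|[|[|//]]]] i4];
  [move: P0|move: P1|move: P2|move: P3]; congr (P _); exact: val_inj.
Qed.

Lemma ord6P (P : 'I_6 -> Prop) :
  P 0 -> P 1 -> P 2 -> P 3 -> P 4 -> P 5 -> forall i, P i.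
Proof.
move=> P0 P1 P2 P3 P4 P5 [[|[|[|[|[|[|//]]]]]] i6];
  [move: P0|move: P1|move: P2|move: P3|move: P4|move: P5];
  congr (P _); exact: val_inj.
Qed.

Lemma setC_ord4 (i j k l : 'I_4) :
  uniq [:: i; j; k; l] -> ~: [set i; j] = [set k; l].
Proof.
rewrite /= !inE !negb_or => /and4P[/and3P[ij ik il] /andP[jk jl] kl _].
apply/esym/eqP; rewrite eqEcard cardsCs finset.setCK card_ord !cards2 ij kl.
rewrite andbT; apply/fintype.subsetP => m; rewrite !inE => /orP[] /eqP->;
  by rewrite negb_or ![_ == i]eq_sym ![_ == j]eq_sym ?ik ?jk ?il.
Qed.

Section Bivectors.
Variable R : realType.
Implicit Types (x y : extpow R 4 2) (u v w z : 'rV[R]_4).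
Implicit Type (e : 4.-tuple 'rV[R]_4).

Lemma sum_lt4 (F : 'I_4 -> 'I_4 -> R) :
  \sum_(i < 4) \sum_(j < 4 | (i < j)%N) F i j =
  F 0 1 + F 0 2 + F 0 3 + F 1 2 + F 1 3 + F 2 3.
Proof.
under eq_bigr do rewrite big_mkcond.
have l1 : lift ord0 ord0 = 1 :> 'I_4 by exact: val_inj.
have l2 : lift ord0 (lift ord0 ord0) = 2 :> 'I_4 by exact: val_inj.
have l3 : lift ord0 (lift ord0 (lift ord0 ord0)) = 3 :> 'I_4 by exact: val_inj.
by rewrite !(big_ord_recl, big_ord0) /= l1 l2 l3 !(add0r, addr0, addrA).
Qed.

(** The coefficient of x /\ y on the top form of the standard basis. *)
Definition wedge_form x y : R :=
  pluecker x 0 1 * pluecker y 2 3 - pluecker x 0 2 * pluecker y 1 3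
  + pluecker x 0 3 * pluecker y 1 2 + pluecker x 1 2 * pluecker y 0 3
  - pluecker x 1 3 * pluecker y 0 2 + pluecker x 2 3 * pluecker y 0 1.

Lemma wedge_eq0 x y : wedge x y = 0 <-> wedge_form x y = 0.
Proof.
have E : scoef (wedge x y) [set: 'I_4] = wedge_form x y.
  rewrite scoef_wedge_setT // big_card2 sum_lt4.
  rewrite (@setC_ord4 0 1 2 3) // (@setC_ord4 0 2 1 3) //.
  rewrite (@setC_ord4 0 3 1 2) // (@setC_ord4 1 2 0 3) //.
  rewrite (@setC_ord4 1 3 0 2) // (@setC_ord4 2 3 0 1) //.
  rewrite !esign22 // !pluecker_scoef // /wedge_form /= !expr0 !expr1.
  by ring.
rewrite -E; split => [->|E0]; first by rewrite scoef0.
apply: scoefP => S; rewrite scoef0.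
have [->//|ST] := eqVneq S [set: 'I_4].
rewrite scoef_eq0 // -[(2 + 2)%N]card_ord; apply: contra ST => /eqP ST.
by rewrite eqEcard finset.subsetT cardsT ST leqnn.
Qed.

Lemma wedge_formC x y : wedge_form x y = wedge_form y x.
Proof. by rewrite /wedge_form; ring. Qed.

Lemma wedge_formZl a x y : wedge_form (a *: x) y = a * wedge_form x y.
Proof. by rewrite /wedge_form !plueckerZ; ring. Qed.

Lemma wedge_form_sumr m (b : 'I_m -> extpow R 4 2) (c : 'I_m -> R) x :
  wedge_form x (\sum_i c i *: b i) = \sum_i c i * wedge_form x (b i).
Proof.
rewrite /wedge_form !pluecker_sum !mulr_sumr.
rewrite -!(sumrB, big_split) /=; apply: eq_bigr => i _.
by rewrite !plueckerZ; ring.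
Qed.

Lemma wedge_form_shared u v w :
  (wedge_form (vwedge u v) (vwedge u w) = 0)
  * (wedge_form (vwedge u v) (vwedge v w) = 0)
  * (wedge_form (vwedge u v) (vwedge w u) = 0)
  * (wedge_form (vwedge u v) (vwedge w v) = 0).
Proof. by rewrite /wedge_form !pluecker_vwedge; do !split; ring. Qed.

Lemma wedge_form_swap u v w z :
  (wedge_form (vwedge u w) (vwedge v z) = - wedge_form (vwedge u v) (vwedge w z))
  * (wedge_form (vwedge u z) (vwedge v w) = wedge_form (vwedge u v) (vwedge w z)).
Proof. by rewrite /wedge_form !pluecker_vwedge; split; ring. Qed.

(** The determinant of [e], obtained as a value of the wedge form. *)
Definition vol e : R :=
  wedge_form (vwedge (tnth e 0) (tnth e 1)) (vwedge (tnth e 2) (tnth e 3)).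

Lemma dim_bivectors : \dim {: extpow R 4 2} = 6%N.
Proof.
rewrite dimvf /dim /= mul1n card_sig.
transitivity 'C(#|'I_4|, 2); last by rewrite card_ord.
by rewrite -card_draws; apply: eq_card => A; rewrite !inE.
Qed.

(** The six products span, because wedge products of vectors do and expand
    bilinearly along [e]; linear independence then follows by counting. *)
Lemma bivector_basisP e : basis_of fullv e -> basis_of fullv (bivector_basis e).
Proof.
move=> eB; rewrite basisEdim dim_bivectors size_tuple leqnn andbT.
rewrite (@span_decomposable _ _ <<bivector_basis e>>) // => u v.
have eT w : w \in <<e>>%VS by rewrite (span_basis eB) memvf.
apply: (vwedge_span (e := e)) => // {u v}.
have bE (k : 'I_6) : (bivector_basis e)`_k \in <<bivector_basis e>>%VS.
  by rewrite memv_span // mem_nth // size_tuple.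
have := (bE 0, bE 1, bE 2, bE 3, bE 4, bE 5).
rewrite /= => -[[[[[b0 b1] b2] b3] b4] b5].
have diag i : vwedge (tnth e i) (tnth e i) \in <<bivector_basis e>>%VS.
  by rewrite vwedge_diag mem0v.
by apply: ord4P; apply: ord4P; rewrite // vwedgeC rpredN.
Qed.

(** The Gram matrix of the basis (e_i /\ e_j) is antidiagonal: two products
    sharing a vector are orthogonal, and complementary ones pair to
    plus or minus [vol e]. *)
Lemma wedge_form_coord e x y :
  basis_of fullv e ->
  let c := coord (bivector_basis e) in
  wedge_form x y = vol e * (c 0 x * c 5 y - c 1 x * c 4 y + c 2 x * c 3 y
                            + c 3 x * c 2 y - c 4 x * c 1 y + c 5 x * c 0 y).
Proof.
move=> /bivector_basisP bB c.
rewrite {1}(coord_basis bB (memvf x)) {1}(coord_basis bB (memvf y)) -/c.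
rewrite wedge_form_sumr; under eq_bigr do rewrite wedge_formC wedge_form_sumr.
have o1 : lift ord0 ord0 = 1 :> 'I_6 by exact: val_inj.
have o2 : lift ord0 (lift ord0 ord0) = 2 :> 'I_6 by exact: val_inj.
have o3 : lift ord0 (lift ord0 (lift ord0 ord0)) = 3 :> 'I_6 by exact: val_inj.
have o4 : lift ord0 (lift ord0 (lift ord0 (lift ord0 ord0))) = 4 :> 'I_6.
  exact: val_inj.
have o5 : lift ord0 (lift ord0 (lift ord0 (lift ord0 (lift ord0 ord0)))) = 5
    :> 'I_6.
  exact: val_inj.
rewrite !(big_ord_recl, big_ord0) o1 o2 o3 o4 o5 /= !wedge_form_shared.
rewrite (wedge_formC (vwedge (tnth e 2) (tnth e 3))).
rewrite (wedge_formC (vwedge (tnth e 1) (tnth e 3)) (vwedge (tnth e 0) _)).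
rewrite (wedge_formC (vwedge (tnth e 1) (tnth e 2)) (vwedge (tnth e 0) _)).
rewrite !(wedge_form_swap (tnth e 0) (tnth e 1) (tnth e 2) (tnth e 3)) -/(vol e).
by ring.
Qed.

(** If [vol e] vanished then so would the whole form, but it takes the value 1
    on the standard basis. *)
Lemma vol_neq0 e : basis_of fullv e -> vol e != 0.
Proof.
move=> eB; apply/eqP => e0.
have := wedge_form_coord (vwedge (delta_mx 0 0) (delta_mx 0 1))
                         (vwedge (delta_mx 0 2) (delta_mx 0 3)) eB.
rewrite /= e0 mul0r /wedge_form !pluecker_vwedge !mxE /=.
by move/eqP; rewrite !(mul0r, mulr0, subr0, addr0, mulr1) oner_eq0.
Qed.

(** * Decomposability of null bivectors *)

(** In dimension 4 all these relations are the single equation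
    x01 x23 - x02 x13 + x03 x12 = 0, up to sign, or trivial when an index is
    repeated. *)
Lemma pluecker_relation x (i j k l : 'I_4) :
  wedge_form x x = 0 -> (i < j)%N -> (k < l)%N ->
  pluecker x i k * pluecker x j l - pluecker x i l * pluecker x j k =
  pluecker x i j * pluecker x k l.
Proof.
rewrite /wedge_form => x0.
have X10 := pluecker_sym x 0 1; have X20 := pluecker_sym x 0 2.
have X30 := pluecker_sym x 0 3; have X21 := pluecker_sym x 1 2.
have X31 := pluecker_sym x 1 3; have X32 := pluecker_sym x 2 3.
move: i j k l; do 4!apply: ord4P => //; move=> _ _;
  rewrite ?pluecker_diag ?X10 ?X20 ?X30 ?X21 ?X31 ?X32; lra.
Qed.

(** By the Pluecker relations the wedge product of rows i and j of the matrix
    of x is x_ij times x; it remains to choose x_ij nonzero and to divide. *)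
Lemma decomposable x :
  x <> 0 -> wedge_form x x = 0 -> exists u v, x = vwedge u v.
Proof.
move=> x0 xx; have [[i [j [ij Xij]]]|X0] :=
  pselect (exists i j : 'I_4, (i < j)%N /\ pluecker x i j != 0).
  exists ((pluecker x i j)^-1 *: \row_k pluecker x i k), (\row_k pluecker x j k).
  apply: plueckerP => k l kl; rewrite vwedgeZl plueckerZ pluecker_vwedge !mxE.
  by rewrite (pluecker_relation xx ij kl) mulKf.
case: x0; apply: plueckerP => i j ij; rewrite pluecker0.
by apply: contrapT => /eqP Xij; apply: X0; exists i, j.
Qed.

Lemma vwedge_extend x : x <> 0 -> wedge_form x x = 0 ->
  exists2 e : 4.-tuple 'rV[R]_4,
    basis_of fullv e & x = vwedge (tnth e 0) (tnth e 1).
Proof.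
move=> x0 /(decomposable x0)[u [v xE]].
have [|Y eB] := @free_extend _ _ [:: u; v].
  by apply: free_vwedge; rewrite -xE.
have sz : size ([:: u; v] ++ Y) == 4.
  by rewrite -(size_basis (X := in_tuple _) eB) dimvf /dim /= mul1n.
by exists (Tuple sz).
Qed.

End Bivectors.

Local Open Scope classical_set_scope.
Local Open Scope ring_scope.

(** * Points, open sets and continuous maps of a projective space *)

Section ProjectiveSpace.
Variables (R : realType) (V : normedModType R).
Implicit Types (p q : projective V) (x y : V).

Lemma mem_nonzero x : x != 0 -> x \in @nonzero R V.
Proof. by move=> /eqP x0; rewrite inE. Qed.

Definition class_of x (x0 : x != 0) : projective V :=
  proj_class (SigSub (mem_nonzero x0) : @nonzero R V).

Lemma is_class_class_of x (x0 : x != 0) : is_class (class_of x0) x.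
Proof. by exists (SigSub (mem_nonzero x0)). Qed.

Lemma is_class_proj_repr p : is_class p (proj_repr p).
Proof.
exists (repr (p : quotient_topology {eq_quot (@proportional R V)}%qT)) => //.
by rewrite /proj_class reprK.
Qed.

Lemma is_class_neq0 p x : is_class p x -> x != 0.
Proof. by move=> [u <- _]; apply/eqP; have := set_valP u. Qed.

Lemma is_class_proportional p x y :
  is_class p x -> is_class p y -> exists2 k : R, k != 0 & y = k *: x.
Proof. by move=> [u <- ->] [v <-] /eqmodP uv; have /asboolP := uv. Qed.

Lemma is_classZ p x (k : R) : k != 0 -> is_class p x -> is_class p (k *: x).
Proof.
move=> k0 px; have kx0 : k *: x != 0.
  by rewrite scaler_eq0 negb_or k0 (is_class_neq0 px).
case: px kx0 => u <- -> kx0; exists (SigSub (mem_nonzero kx0)) => //.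
by apply/eqmodP/asboolP; exists k.
Qed.

Lemma is_class_inj p q x : is_class p x -> is_class q x -> p = q.
Proof. by move=> [u <- ->] [v /val_inj -> ->]. Qed.

Lemma open_projective (O : set (projective V)) (A : set V) :
  open A -> (forall p x, is_class p x -> O p <-> A x) -> open O.
Proof.
move=> oA OA; rewrite /open /=.
exists A => //; apply/seteqP; split => u /=.
  by move=> Au; apply/(OA _ (set_val u)) => //; exists u.
by move=> Ou; apply/(OA (proj_class u)) => //; exists u.
Qed.

(** The universal property of the quotient topology, restricted to an open set
    of classes: [g] describes [f] on representatives. *)
Lemma projective_continuous (T : topologicalType) (O : set (projective V))
    (A : set V) (f : projective V -> T) (g : V -> T) :
  open A -> (forall p x, is_class p x -> O p <-> A x) ->
  (forall p x, is_class p x -> A x -> f p = g x) ->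
  {in A, continuous g} -> {in O, continuous f}.
Proof.
move=> oA OA fg /(continuous_inP _ oA) gA.
apply/(continuous_inP _ (open_projective oA OA)) => B oB.
apply: (open_projective (gA B oB)) => p x px; split=> -[Op fB].
  have Ax := (OA _ _ px).1 Op; split=> //=.
  by rewrite -(fg _ _ px Ax).
by split; [apply/(OA _ _ px)|rewrite /= (fg _ _ px Op)].
Qed.

Lemma class_of_continuous (S : topologicalType) (h : S -> V)
    (h0 : forall s, h s != 0) :
  continuous h -> continuous (fun s => class_of (h0 s)).
Proof.
move=> hc s; apply: (@continuous_comp _ _ _
  (fun s => SigSub (mem_nonzero (h0 s)) : @nonzero R V) (@proj_class R V)).
  exact: (@continuous_comp_initial _ _ _ set_val).
exact: pi_continuous.
Qed.

End ProjectiveSpace.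

(** * Continuity of maps between row vector spaces *)

Section RowContinuity.
Variable R : realType.

Lemma row_continuous (T : topologicalType) n (F : T -> 'I_n -> R) (t : T) :
  (forall k, F ^~ k @ t --> F t k) ->
  (fun t => \row_k F t k) @ t --> \row_k F t k.
Proof.
move=> Fc A [P PA sub].
have : \forall s \near t, forall ij : 'I_1 * 'I_n, P ij.1 ij.2 (F s ij.2).
  apply: filter_forall => -[i j] /=; apply: Fc.
  by have := PA i j; rewrite mxE.
by apply: filterS => s sP; apply: sub => i j; rewrite mxE; exact: (sP (i, j)).
Qed.

Lemma scalar_row_continuous n (f : {scalar 'rV[R]_n}) :
  continuous (f : 'rV[R]_n -> R).
Proof.
rewrite (_ : (f : 'rV[R]_n -> R) = fun x => \sum_i x 0 i * f (delta_mx 0 i)).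
  apply: continuous_big => [|i _ x]; first exact: add_continuous.
  by apply: (@cvgMr_tmp _ _ (nbhs x)); exact: (@coord_continuous R 1 n 0 i x).
apply/funext => x; rewrite {1}(row_sum_delta x) linear_sum.
by apply: eq_bigr => i _; rewrite linearZ.
Qed.

End RowContinuity.

(** * The chart of the Grassmannian centred at [e1 /\ e2] *)

Section Chart.
Variables (R : realType) (e : 4.-tuple 'rV[R]_4).
Hypothesis e_basis : basis_of fullv e.

Let b_basis : basis_of fullv (bivector_basis e) := bivector_basisP e_basis.
Local Notation c i x := (coord (bivector_basis e) i x).
Local Notation e12 := (vwedge (tnth e 0) (tnth e 1)).

Lemma coord_e12 i : c i e12 = (0 == i)%:R.
Proof. exact: (coord_free 0 i (basis_free b_basis)). Qed.

Lemma Gr24_coord (p : PL2 R) x : is_class p x ->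
  Gr24 p <-> c 0 x * c 5 x = c 1 x * c 4 x - c 2 x * c 3 x.
Proof.
move=> px; have D0 := vol_neq0 e_basis.
have formE : wedge_form x x = 2 * vol e *
    (c 0 x * c 5 x - (c 1 x * c 4 x - c 2 x * c 3 x)).
  by rewrite (wedge_form_coord _ _ e_basis) /=; ring.
have -> : Gr24 p <-> wedge_form x x = 0.
  split; last by move=> /wedge_eq0 xx; exists x.
  move=> [y py /wedge_eq0 yy]; have [k k0 ->] := is_class_proportional py px.
  by rewrite wedge_formZl wedge_formC wedge_formZl yy !mulr0.
rewrite formE; split=> [/eqP|->]; last by rewrite subrr mulr0.
by rewrite !mulf_eq0 pnatr_eq0 (negbTE D0) /= subr_eq0 => /eqP.
Qed.

Lemma W_fiber_coord (p1 p : PL2 R) x :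
  is_class p1 e12 -> Gr24 p1 -> is_class p x ->
  W_fiber p1 p <-> Gr24 p /\ c 5 x = 0.
Proof.
move=> p1e p1Gr px; have D0 := vol_neq0 e_basis.
have e12x : wedge_form e12 x = vol e * c 5 x.
  by rewrite (wedge_form_coord _ _ e_basis) /= !coord_e12 /=; ring.
split=> [[_ pGr [y [z [p1y pz /wedge_eq0 yz]]]]|[pGr x5]].
  split=> //; have [k k0 yE] := is_class_proportional p1e p1y.
  have [l l0 zE] := is_class_proportional px pz.
  move: yz; rewrite /= yE zE wedge_formZl wedge_formC wedge_formZl wedge_formC.
  rewrite e12x => /eqP.
  by rewrite !mulf_eq0 (negbTE k0) (negbTE l0) (negbTE D0) => /eqP.
split=> //; exists e12, x; split=> //.
by apply/wedge_eq0; rewrite e12x x5 mulr0.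
Qed.

(** The chart as a function of the bivector. [chart] itself goes through a
    chosen representative of the class, which need not vary continuously. *)
Definition affine_coord (x : extpow R 4 2) : 'rV[R]_4 :=
  \row_(k < 4)
    [:: c 1 x / c 0 x; c 2 x / c 0 x; c 3 x / c 0 x; c 4 x / c 0 x]`_k.

Lemma hcoord_proportional (p : PL2 R) x : is_class p x ->
  exists2 k : R, k != 0 & forall i, hcoord e p i = k * c i x.
Proof.
move=> px; have [k k0 E] := is_class_proportional px (is_class_proj_repr p).
by exists k => // i; rewrite /hcoord E linearZ.
Qed.

Lemma hcoord0_neq0 (p : PL2 R) x : is_class p x ->
  hcoord e p 0 <> 0 <-> c 0 x != 0.
Proof.
move=> /hcoord_proportional[k k0 ->].
split=> [/eqP|x0]; rewrite ?mulf_eq0 ?negb_or; first by case/andP.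
by apply/eqP; rewrite mulf_neq0.
Qed.

Lemma chartE (p : PL2 R) x : is_class p x -> chart e p = affine_coord x.
Proof.
move=> /hcoord_proportional[k k0 E]; rewrite /chart /affine_coord !E.
have kk (a d : R) : k * a / (k * d) = a / d.
  by rewrite invfM mulrACA divff ?mul1r.
by apply/rowP => i; rewrite !mxE !kk.
Qed.

Definition chart_inv_coord (v : 'rV[R]_4) (i : 'I_6) : R :=
  [:: 1; v 0 0; v 0 1; v 0 2; v 0 3; v 0 0 * v 0 3 - v 0 1 * v 0 2]`_i.

Definition chart_inv_bivector (v : 'rV[R]_4) : extpow R 4 2 :=
  \sum_(i < 6) chart_inv_coord v i *: (bivector_basis e)`_i.

Lemma coord_chart_inv v i : c i (chart_inv_bivector v) = chart_inv_coord v i.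
Proof. exact: coord_sum_free (basis_free b_basis). Qed.

Lemma chart_inv_neq0 v : chart_inv_bivector v != 0.
Proof.
apply/eqP => v0; have := coord_chart_inv v 0; rewrite v0 linear0.
by rewrite /chart_inv_coord /= => /esym/eqP; rewrite oner_eq0.
Qed.

Definition chart_inv (v : 'rV[R]_4) : PL2 R := class_of (chart_inv_neq0 v).

Lemma is_class_chart_inv v : is_class (chart_inv v) (chart_inv_bivector v).
Proof. exact: is_class_class_of. Qed.

Lemma chart_inv_continuous : continuous chart_inv.
Proof.
apply: class_of_continuous.
apply: continuous_big => [|i _ v]; first exact: add_continuous.
apply: (@cvgZr_tmp _ _ _ (nbhs v)).
have v_cont k : {for v, continuous (fun w : 'rV[R]_4 => w 0 k)}.
  exact: (@coord_continuous R 1 4 0 k v).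
move: i; apply: ord6P; rewrite /chart_inv_coord /=; try exact: v_cont.
  exact: cvg_cst.
by apply: cvgB; apply: cvgM; exact: v_cont.
Qed.

Lemma chart_domain_inv v : chart_domain e (chart_inv v).
Proof.
have vv := is_class_chart_inv v; split.
  by apply/(Gr24_coord vv); rewrite !coord_chart_inv /chart_inv_coord /=; ring.
by apply/(hcoord0_neq0 vv); rewrite coord_chart_inv oner_eq0.
Qed.

Lemma chart_invK v : chart e (chart_inv v) = v.
Proof.
rewrite (chartE (is_class_chart_inv v)); apply/rowP => k.
rewrite mxE !coord_chart_inv /chart_inv_coord /= !divr1.
by move: k; apply: ord4P.
Qed.

(** Rescaling a representative to first coordinate 1 gives back the one built
    from the chart: its last coordinate is forced by the quadric equation. *)
Lemma chartK p : chart_domain e p -> chart_inv (chart e p) = p.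
Proof.
move=> [pGr p0]; have px := is_class_proj_repr p; set x := proj_repr p in px.
have /(hcoord0_neq0 px) x0 := p0.
have x5 := (Gr24_coord px).1 pGr.
have vx : chart_inv_bivector (chart e p) = (c 0 x)^-1 *: x.
  rewrite [X in _ *: X](coord_basis b_basis (memvf x)) scaler_sumr.
  apply: eq_bigr => i _; rewrite scalerA; congr (_ *: _).
  rewrite (chartE px) /chart_inv_coord !mxE /=.
  move: i; apply: ord6P => /=; rewrite ?mulVf //; try by rewrite mulrC.
  by rewrite -[c 5 x](mulKf x0) x5; field.
apply: (@is_class_inj _ _ _ _ _ (is_class_chart_inv _)).
by rewrite vx; apply: is_classZ => //; rewrite invr_eq0.
Qed.

Lemma bivector_coord_continuous i (x : extpow R 4 2) :
  {for x, continuous (fun x => c i x)}.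
Proof. exact: (@scalar_row_continuous R _ (coord (bivector_basis e) i)). Qed.

Lemma open_coord0 : open [set x : extpow R 4 2 | c 0 x != 0].
Proof.
have -> : [set x : extpow R 4 2 | c 0 x != 0] =
    (fun x : extpow R 4 2 => c 0 x) @^-1` [set t | t != 0] by [].
apply: open_comp; last exact: open_neq.
by move=> x _; exact: bivector_coord_continuous.
Qed.

Lemma chart_continuous :
  {in [set p : PL2 R | hcoord e p 0 <> 0], continuous (chart e)}.
Proof.
apply: (projective_continuous (g := affine_coord) open_coord0 hcoord0_neq0).
  by move=> p x px _; exact: chartE.
move=> x /set_mem x0; apply: row_continuous => k.
have ratio i : {for x, continuous (fun y : extpow R 4 2 => c i y / c 0 y)}.
  apply: continuousM; first exact: bivector_coord_continuous.
  by apply: continuousV => //; exact: bivector_coord_continuous.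
by move: k; apply: ord4P; apply: ratio.
Qed.

Lemma chart_local_coordinates (p1 : PL2 R) :
  Gr24 p1 -> is_class p1 e12 ->
  local_coordinates (@Gr24 R) p1 (chart_domain e) (chart e).
Proof.
move=> p1Gr p1e; split.
- exists [set p : PL2 R | hcoord e p 0 <> 0] => //.
  exact: (open_projective open_coord0 hcoord0_neq0).
- by split=> //; apply/(hcoord0_neq0 p1e); rewrite coord_e12 oner_eq0.
- rewrite (chartE p1e); apply/rowP => k; rewrite !mxE !coord_e12 /= !mul0r.
  by move: k; apply: ord4P.
- apply: (@continuous_subspaceW _ _ _ [set p : PL2 R | hcoord e p 0 <> 0]).
    by move=> p [].
  exact: continuous_in_subspaceT chart_continuous.
exists chart_inv; split.
- exact: chart_inv_continuous.
- exact: chart_domain_inv.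
- exact: chart_invK.
- exact: chartK.
Qed.

(** The coordinate q34 of the point with chart value v is v0 v3 - v1 v2 by
    construction, and q34 = 0 is the equation of W. *)
Lemma chart_W_fiber (p1 : PL2 R) :
  Gr24 p1 -> is_class p1 e12 ->
  chart e @` (W_fiber p1 `&` chart_domain e) = @quadric_cone R.
Proof.
move=> p1Gr p1e; apply/seteqP; split=> [_ [p [Wp pU] <-]|v v_cone].
  move: Wp; rewrite /quadric_cone /= -(chartK pU).
  move=> /(W_fiber_coord p1e p1Gr (is_class_chart_inv _))[_].
  by rewrite chart_invK coord_chart_inv.
exists (chart_inv v); last exact: chart_invK.
split; last exact: chart_domain_inv.
apply/(W_fiber_coord p1e p1Gr (is_class_chart_inv v)); split.
  by case: (chart_domain_inv v).
by rewrite coord_chart_inv.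
Qed.

End Chart.

Theorem proposition5p2 (R : realType) (p1 : PL2 R) (Hp1 : Gr24 p1) :
  (exists2 e : 4.-tuple 'rV[R]_4,
     basis_of fullv e & is_class p1 (vwedge (tnth e 0) (tnth e 1))) /\
  (forall e : 4.-tuple 'rV[R]_4,
     basis_of fullv e -> is_class p1 (vwedge (tnth e 0) (tnth e 1)) ->
     local_coordinates (@Gr24 R) p1 (chart_domain e) (chart e) /\
     chart e @` (W_fiber p1 `&` chart_domain e) = @quadric_cone R).
Proof.
split.
  have [x p1x /wedge_eq0 xx] := Hp1.
  have /eqP x0 := is_class_neq0 p1x.
  have [e e_basis xE] := vwedge_extend x0 xx.
  by exists e => //; rewrite -xE.
move=> e e_basis p1e; split; first exact: chart_local_coordinates.
exact: chart_W_fiber.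
Qed.
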